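(* Let $\mathcal{D}$ be a dialgebra over a field $K$ of characteristic zero. Then the space $\mathrm{Inn}(\mathcal{D})$ of inner derivations of $\mathcal{D}$ is an ideal of the Lie algebra $\mathrm{Der}(\mathcal{D})$ of derivations of $\mathcal{D}$.
   Context: A dialgebra over $K$ is a $K$-vector space $\mathcal{D}$ with two bilinear associative products $\vdash,\dashv:\mathcal{D}\times\mathcal{D}\to\mathcal{D}$ satisfying, for all $x,y,z\in\mathcal{D}$: $x\dashv(y\dashv z)=x\dashv(y\vdash z)$, $(x\dashv y)\vdash z=(x\vdash y)\vdash z$, and $x\vdash(y\dashv z)=(x\vdash y)\dashv z$. A derivation of $\mathcal{D}$ is a $K$-linear map $d:\mathcal{D}\to\mathcal{D}$ such that $d(a*b)=d(a)*b+a*d(b)$ for all $a,b\in\mathcal{D}$ and for each of the two products $*\in\{\vdash,\dashv\}$. $\mathrm{Der}(\mathcal{D})$ is the vector space of all derivations of $\mathcal{D}$, a Lie algebra under the commutator $[S,T]=ST-TS$. For $a\in\mathcal{D}$, $\mathrm{ad}_a:\mathcal{D}\to\mathcal{D}$ is the linear map $\mathrm{ad}_a(b)=b\dashv a-a\vdash b$; these maps are derivations of $\mathcal{D}$, called inner derivations. $\mathrm{Inn}(\mathcal{D})$ is the linear span of $\{\mathrm{ad}_a : a\in\mathcal{D}\}$. *)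

(* Defs.v *)
From HB Require Import structures.
From mathcomp Require Import all_boot all_order all_algebra sesquilinear.
From mathcomp Require Import boolp classical_sets functions.

Set Implicit Arguments.
Unset Strict Implicit.
Unset Printing Implicit Defensive.

Import GRing.Theory.

Local Open Scope ring_scope.

Declare Scope dialgebra_scope.
Local Open Scope dialgebra_scope.

HB.mixin Record Lmodule_isDialgebra (K : fieldType) D
    of GRing.Lmodule K D := {
  dlprod : D -> D -> D;
  drprod : D -> D -> D;
  dlprod_bilinear : bilinear_for *:%R *:%R dlprod;
  drprod_bilinear : bilinear_for *:%R *:%R drprod;
  dlprodA : associative dlprod;
  drprodA : associative drprod;
  drprod_inner : forall x y z : D,
    drprod x (drprod y z) = drprod x (dlprod y z);
  dlprod_inner : forall x y z : D,
    dlprod (drprod x y) z = dlprod (dlprod x y) z;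
  dlrprodA : forall x y z : D,
    dlprod x (drprod y z) = drprod (dlprod x y) z
}.

#[short(type="dialgType")]
HB.structure Definition Dialgebra (K : fieldType) :=
  { D of GRing.Lmodule K D & Lmodule_isDialgebra K D }.

Notation "x ⊢ y" := (dlprod x y)
  (at level 40, left associativity) : dialgebra_scope.
Notation "x ⊣ y" := (drprod x y)
  (at level 40, left associativity) : dialgebra_scope.

HB.mixin Record Lmodule_isLieAlgebra (K : fieldType) L
    of GRing.Lmodule K L := {
  lie_bracket : L -> L -> L;
  lie_bracket_bilinear : bilinear_for *:%R *:%R lie_bracket;
  lie_bracketxx : forall x : L, lie_bracket x x = 0;
  lie_jacobi : forall x y z : L,
    lie_bracket x (lie_bracket y z) + lie_bracket y (lie_bracket z x)
      + lie_bracket z (lie_bracket x y) = 0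
}.

#[short(type="lieAlgType")]
HB.structure Definition LieAlgebra (K : fieldType) :=
  { L of GRing.Lmodule K L & Lmodule_isLieAlgebra K L }.

(* The other side, [y, x] \in I, follows since the bracket is antisymmetric. *)
Definition lie_ideal (K : fieldType) (L : lieAlgType K) (I : {pred L}) : Prop :=
  submod_closed I /\ (forall x y : L, y \in I -> lie_bracket x y \in I).

(* The library's span only covers finite sequences of vectors in
   finite-dimensional spaces. *)
Definition linear_span (K : fieldType) (V : lmodType K) (S : set V) :
    {pred V} :=
  fun v => `[< exists n (c : 'I_n -> K) (s : 'I_n -> V),
                 (forall i, S (s i)) /\ v = \sum_(i < n) c i *: s i >].

Section Derivation.
Variables (K : fieldType) (D : dialgType K).
Implicit Types (a b : D) (f g : D -> D).

Definition is_derivation f : Prop :=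
  [/\ linear f,
      forall a b, f (a ⊢ b) = f a ⊢ b + a ⊢ f b &
      forall a b, f (a ⊣ b) = f a ⊣ b + a ⊣ f b].

Definition derivation_pred : {pred D -> D} := fun f => `[< is_derivation f >].

Lemma derivationP f : reflect (is_derivation f) (f \in derivation_pred).
Proof. exact: asboolP. Qed.

HB.instance Definition _ := bilinear_isBilinear.Build K D D D *:%R *:%R
  (@dlprod K D) dlprod_bilinear.
HB.instance Definition _ := bilinear_isBilinear.Build K D D D *:%R *:%R
  (@drprod K D) drprod_bilinear.

Lemma derivation_submod_closed : submod_closed derivation_pred.
Proof.
split=> [|k f g /derivationP[lf fl fr] /derivationP[lg gl gr]].
  apply/derivationP; split=> [k a b|a b|a b] /=.
  - by rewrite scaler0 addr0.
  - by rewrite linear0l linear0r addr0.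
  - by rewrite linear0l linear0r addr0.
apply/derivationP; split=> [c a b|a b|a b].
- rewrite !fctE lf lg !scalerDr !scalerA [c * k]mulrC -!addrA.
  by congr (_ + _); rewrite addrCA.
- by rewrite !fctE fl gl scalerDr linearDl linearDr linearZl_LR linearZr_LR addrACA.
- by rewrite !fctE fr gr scalerDr linearDl linearDr linearZl_LR linearZr_LR addrACA.
Qed.

HB.instance Definition _ := GRing.isSubmodClosed.Build K (D -> D)
  derivation_pred derivation_submod_closed.

Record derivation := Derivation {
  derivation_fun :> D -> D;
  derivation_funP : derivation_fun \in derivation_pred
}.

HB.instance Definition _ := [isSub of derivation for derivation_fun].
HB.instance Definition _ := [Choice of derivation by <:].
HB.instance Definition _ := [SubChoice_isSubLmodule of derivation by <:].

Lemma derivation_funE (d : derivation) : is_derivation d.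
Proof. exact/derivationP/derivation_funP. Qed.

HB.instance Definition _ (d : derivation) :=
  GRing.isLinear.Build K D D *:%R d (let: And3 l _ _ := derivation_funE d in l).

Lemma derivationD (d : derivation) : {morph d : a b / a + b}.
Proof. exact: linearD. Qed.

Lemma derivationB (d : derivation) : {morph d : a b / a - b}.
Proof. exact: linearB. Qed.

Lemma derivation_linear (d : derivation) (k : K) a b :
  d (k *: a + b) = k *: d a + d b.
Proof. exact: linearP. Qed.

Definition commutator f g : D -> D := (f \o g) - (g \o f).

Lemma zmod_cancel_cross (V : zmodType) (p q r s u v : V) :
  p + u + (v + r) - (q + v + (u + s)) = (p - q) + (r - s).
Proof.
have -> : p + u + (v + r) = p + r + (u + v) by rewrite [v + r]addrC addrACA.
have -> : q + v + (u + s) = q + s + (u + v).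
  by rewrite [u + s]addrC addrACA [v + u]addrC.
by rewrite opprD [- (q + s) - _]addrC addrA addrK opprD addrACA.
Qed.

Lemma zmod_jacobi (V : zmodType) (p q r s t u : V) :
  p - q - (r - s) + (r - t - (u - q)) + (u - s - (p - t)) = 0.
Proof.
have E (a b c d : V) : a - b - (c - d) = (a + d) - (b + c).
  by rewrite opprB opprD addrACA.
rewrite !E [r + q]addrC [u + t]addrC [s + p]addrC.
by rewrite [X in X + _]addrA subrK addrA subrK subrr.
Qed.

Lemma commutator_derivation (S T : derivation) :
  commutator S T \in derivation_pred.
Proof.
have [[lS Sl Sr] [lT Tl Tr]] := (derivation_funE S, derivation_funE T).
apply/derivationP; split=> [k a b|a b|a b]; rewrite /commutator !fctE /=.
- by rewrite lT lS lS lT opprD addrACA scalerBr.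
- rewrite Tl Sl !derivationD !Sl !Tl.
  by rewrite linearDl linearDr linearNl linearNr zmod_cancel_cross.
- rewrite Tr Sr !derivationD !Sr !Tr.
  by rewrite linearDl linearDr linearNl linearNr zmod_cancel_cross.
Qed.

Definition derivation_bracket (S T : derivation) : derivation :=
  Derivation (commutator_derivation S T).

Lemma derivation_eqP (S T : derivation) : (forall x, S x = T x) -> S = T.
Proof. by move=> eqST; apply/val_inj/funext. Qed.

Lemma derivationDE (S T : derivation) x : (S + T) x = S x + T x.
Proof. by []. Qed.

Lemma derivationZE (k : K) (S : derivation) x : (k *: S) x = k *: S x.
Proof. by []. Qed.

Lemma derivation0E x : (0 : derivation) x = 0.
Proof. by []. Qed.

Lemma derivation_bracketE (S T : derivation) x :
  derivation_bracket S T x = S (T x) - T (S x).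
Proof. by []. Qed.

Let derE :=
  (derivation_bracketE, derivationDE, derivationZE, derivation0E).

Lemma derivation_bracket_bilinear :
  bilinear_for *:%R *:%R derivation_bracket.
Proof.
split=> [T k S S'|S k T T']; apply: derivation_eqP => x; rewrite !derE.
- by rewrite derivation_linear opprD addrACA scalerBr.
- by rewrite derivation_linear opprD addrACA scalerBr.
Qed.

Lemma derivation_bracketxx (S : derivation) : derivation_bracket S S = 0.
Proof. by apply: derivation_eqP => x; rewrite !derE subrr. Qed.

Lemma derivation_jacobi (x y z : derivation) :
  derivation_bracket x (derivation_bracket y z)
    + derivation_bracket y (derivation_bracket z x)
    + derivation_bracket z (derivation_bracket x y) = 0.
Proof.
apply: derivation_eqP => a; rewrite !derE.
by rewrite !derivationB zmod_jacobi.
Qed.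

HB.instance Definition _ := Lmodule_isLieAlgebra.Build K derivation
  derivation_bracket_bilinear derivation_bracketxx derivation_jacobi.

Definition ad a : D -> D := fun b => b ⊣ a - a ⊢ b.

Lemma ad_derivation a : ad a \in derivation_pred.
Proof.
apply/derivationP; split=> [k x y|x y|x y]; rewrite /ad.
- rewrite linearDl linearZl_LR linearDr linearZr_LR opprD addrACA.
  by rewrite scalerBr.
- rewrite linearDl linearDr linearNl linearNr /=.
  by rewrite dlrprodA dlprod_inner !dlprodA [RHS]addrC addrA subrK.
- rewrite linearDl linearDr linearNl linearNr /=.
  by rewrite dlrprodA -drprod_inner !drprodA [RHS]addrC addrA subrK.
Qed.

Definition inner_derivation a : derivation := Derivation (ad_derivation a).

Definition Inn : {pred derivation} := linear_span (range inner_derivation).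

End Derivation.

Arguments Inn {K} D.

(* Main.v *)
From HB Require Import structures.
Require Import Defs.
From mathcomp Require Import all_boot all_order all_algebra.
From mathcomp Require Import sesquilinear boolp classical_sets.

Set Implicit Arguments.
Unset Strict Implicit.
Unset Printing Implicit Defensive.

Local Open Scope ring_scope.

(** A linear span is a submodule, so the only point is stability under the
    bracket with a derivation [d]. Applying [d] to [b ⊣ a - a ⊢ b] and using the
    Leibniz rule for both products gives [[d, ad a] = ad (d a)]
    ([bracket_inner_derivation]); hence the bracket with [d], being linear,
    maps the span of the inner derivations [ad a] to itself. *)

Import GRing.Theory.

Section LinearSpan.
Variables (K : fieldType) (V : lmodType K) (S : set V).

Lemma linear_spanP (v : V) :
  reflect (exists n (c : 'I_n -> K) (s : 'I_n -> V),
             (forall i, S (s i)) /\ v = \sum_(i < n) c i *: s i)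
          (v \in linear_span S).
Proof. exact: asboolP. Qed.

Lemma linear_span_submod_closed : submod_closed (linear_span S).
Proof.
split=> [|k _ _ /linear_spanP[n [c [s [Ss ->]]]] /linear_spanP[m [e [t [St ->]]]]].
  apply/linear_spanP; exists 0%N, (fun=> 0), (fun=> 0).
  by split=> [[]|]; rewrite ?big_ord0.
apply/linear_spanP; exists (n + m)%N.
exists (fun i => match split i with inl j => k * c j | inr j => e j end).
exists (fun i => match split i with inl j => s j | inr j => t j end).
split=> [i|]; first by case: (split i).
rewrite big_split_ord scaler_sumr; congr (_ + _); apply: eq_bigr => i _.
  by rewrite -[lshift m i]/(unsplit (inl i)) unsplitK scalerA.
by rewrite -[rshift n i]/(unsplit (inr i)) unsplitK.
Qed.

End LinearSpan.

HB.instance Definition _ (K : fieldType) (L : lieAlgType K) :=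
  bilinear_isBilinear.Build K L L L *:%R *:%R
    (@lie_bracket K L) lie_bracket_bilinear.

Lemma bracket_inner_derivation (K : fieldType) (D : dialgType K)
    (d : derivation D) (a : D) :
  lie_bracket d (inner_derivation a) = inner_derivation (d a).
Proof.
apply: derivation_eqP => b; rewrite derivation_bracketE /= /ad derivationB.
have [_ dl dr] := derivation_funE d.
(* The terms [d b ⊣ a] and [a ⊢ d b] cancel. *)
by rewrite dl dr [X in X - _ - _]addrC opprD addrACA addrK.
Qed.

Theorem theorem2p6 (K : fieldType) (D : dialgType K)
    (charK0 : [pchar K] =i pred0) :
  lie_ideal (L := derivation D) (Inn D).
Proof.
split=> [|d _ /linear_spanP[n [c [s [Ss ->]]]]].
  exact: linear_span_submod_closed.
apply/linear_spanP; exists n, c, (fun i => lie_bracket d (s i)); split=> [i|].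
  by have [a _ <-] := Ss i; rewrite bracket_inner_derivation; exists (d a).
by rewrite linear_sumr; apply: eq_bigr => i _; rewrite linearZr_LR.
Qed.
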